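(* Let $\mathcal{A}=(\mathbf{A}_1,\mathbf{A})$ be a quantum space. (1) Given an $\mathcal{A}$-admissible $\psi\in\mathfrak{Z}^2[\mathbf{A}_1]$, one has $\mathcal{A}\simeq\mathcal{A}_\psi$ (isomorphism of quantum spaces) if and only if $\psi=\partial\theta$ for some $\mathcal{A}$-admissible counital 1-cochain $\theta$. (2) More generally, given two $\mathcal{A}$-admissible counital 2-cocycles $\varphi,\psi\in\mathfrak{Z}^2[\mathbf{A}_1]$, one has $\mathcal{A}_\varphi\simeq\mathcal{A}_\psi$ if and only if $\varphi$ and $\psi$ are cohomologous through an $\mathcal{A}$-admissible counital 1-cochain $\theta$. (3) In particular, if $\Pi^{\otimes2}(\varphi-\psi)=0$, then $\varphi\backsim_\theta\psi$ through an $\mathcal{A}$-admissible $\theta$.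
   Context: $\Bbbk$ is $\mathbb{R}$ or $\mathbb{C}$. A quantum space (object of $\mathrm{FGA}$) is a pair $\mathcal{A}=(\mathbf{A}_1,\mathbf{A})$ with $\mathbf{A}$ a unital associative $\Bbbk$-algebra generated by a finite-dimensional subspace $\mathbf{A}_1\subset\mathbf{A}$; morphisms $(\mathbf{A}_1,\mathbf{A})\to(\mathbf{B}_1,\mathbf{B})$ are unital algebra maps $\mathbf{A}\to\mathbf{B}$ sending $\mathbf{A}_1$ into $\mathbf{B}_1$. $\Pi:\mathbf{A}_1^\otimes\twoheadrightarrow\mathbf{A}$ is the canonical epimorphism from the tensor algebra. For a vector space $\mathbf{V}$, $\mathsf{C}^1[\mathbf{V}]$ is the group of linear automorphisms $\theta$ of $\mathbf{V}^\otimes$ with $\theta(\mathbf{V}^{\otimes r})=\mathbf{V}^{\otimes r}$ for all $r$, and $\mathsf{C}^2[\mathbf{V}]$ the group of linear automorphisms $\psi$ of $\mathbf{V}^\otimes\otimes\mathbf{V}^\otimes$ preserving each $\mathbf{V}^{\otimes r}\otimes\mathbf{V}^{\otimes s}$; subscripts denote restrictions. For $\theta\in\mathsf{C}^1[\mathbf{V}]$, $\delta_1\theta\in\mathsf{C}^2[\mathbf{V}]$ is given on $\mathbf{V}^{\otimes r}\otimes\mathbf{V}^{\otimes s}$ by $\theta_{r+s}$ under the multiplication isomorphism $\mathbf{V}^{\otimes r}\otimes\mathbf{V}^{\otimes s}\cong\mathbf{V}^{\otimes r+s}$, and $\partial\theta=\delta_1\theta\,(\theta\otimes\theta)^{-1}$.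 With the same identifications, $\psi\in\mathsf{C}^2[\mathbf{V}]$ is a 2-cocycle if $\psi_{r+s,t}(\psi_{r,s}\otimes id_t)=\psi_{r,s+t}(id_r\otimes\psi_{s,t})$ for all $r,s,t$. $\psi$ is counital if $\psi(1\otimes a)=1\otimes a$, $\psi(a\otimes1)=a\otimes1$; $\theta$ is counital if $\theta(1)=1$. $\mathfrak{Z}^2[\mathbf{V}]$ is the set of counital 2-cocycles. Two 2-cochains $\varphi,\psi$ are cohomologous through $\theta\in\mathsf{C}^1[\mathbf{V}]$, written $\varphi\backsim_\theta\psi$, if $\delta_1\theta\,\varphi\,(\theta\otimes\theta)^{-1}=\psi$. An $n$-cochain $\psi\in\mathsf{C}^n[\mathbf{A}_1]$ ($n=1,2$) is $\mathcal{A}$-admissible if $\psi(\ker\Pi^{\otimes n})=\ker\Pi^{\otimes n}$. For $\mathcal{A}$-admissible $\psi\in\mathfrak{Z}^2[\mathbf{A}_1]$, the twisting of $\mathcal{A}$ by $\psi$ is the quantum space $\mathcal{A}_\psi=(\mathbf{A}_1,\mathbf{A}_\psi)$, where $\mathbf{A}_\psi$ is the vector space $\mathbf{A}$ with the same unit and product $m_\psi=m\,\Psi$, $m$ being the product of $\mathbf{A}$ and $\Psi$ the linear automorphism of $\mathbf{A}\otimes\mathbf{A}$ with $\Psi\,\Pi^{\otimes2}=\Pi^{\otimes2}\,\psi$. *)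

(* Defs.v *)
From HB Require Import structures.
From mathcomp Require Import all_boot all_order all_algebra generic_quotient.
From mathcomp Require Import boolp classical_sets reals.
From mathcomp Require Import complex.

Set Implicit Arguments.
Unset Strict Implicit.
Unset Printing Implicit Defensive.

Import Order.TTheory GRing.Theory Num.Theory.
Local Open Scope classical_set_scope.
Local Open Scope ring_scope.

(* Unital associative algebras; [algType] is not used because it is built on    *)
(* nontrivial rings and excludes the zero algebra.                              *)
Record unitalAlg (K : fieldType) := UnitalAlg {
  acarrier :> lmodType K ;
  aone : acarrier ;
  amul : acarrier -> acarrier -> acarrier ;
  amul_bilinear : bilinear_for *:%R *:%R amul ;
  amulA : associative amul ;
  amul1 : left_id aone amul ;
  amulr1 : right_id aone amul
}.

Arguments aone {K}.
Arguments amul {K A} : rename.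

Section Span.
Context {K : fieldType}.

Definition is_submodule (U : lmodType K) (S : set U) :=
  S 0 /\ forall (a : K) u v, S u -> S v -> S (a *: u + v).

Definition lspan (U : lmodType K) (S : set U) : set U := smallest (@is_submodule U) S.

Definition is_subalgebra (A : unitalAlg K) (S : set A) :=
  [/\ is_submodule S, S (aone A) & forall x y, S x -> S y -> S (amul x y)].

Definition subalg (A : unitalAlg K) (S : set A) : set A :=
  smallest (@is_subalgebra A) S.

Lemma lspan_sub (U : lmodType K) (S : set U) u : S u -> lspan S u.
Proof. by move=> Su M [_ SM]; apply: SM. Qed.

Lemma lspan_submod (U : lmodType K) (S : set U) : is_submodule (lspan S).
Proof.
split=> [M [[M0 _] _]//|a u v Su Sv M MP].
by apply: (MP.1.2); [apply: Su|apply: Sv].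
Qed.

Lemma lspan_ind (U : lmodType K) (S M : set U) :
  is_submodule M -> S `<=` M -> lspan S `<=` M.
Proof. by move=> Mm SM u; apply. Qed.

Lemma preim_submod (U W : lmodType K) (f : {linear U -> W}) (M : set W) :
  is_submodule M -> is_submodule (f @^-1` M).
Proof.
by case=> M0 MP; split=> [|a u v Mu Mv]; rewrite /preimage /= ?linear0 ?linearP //; apply: MP.
Qed.

Lemma eq_submod (U W : lmodType K) (f g : {linear U -> W}) :
  is_submodule [set u | f u = g u].
Proof. by split=> [|a u v /= fu fv]; rewrite /= ?linear0 // !linearP fu fv. Qed.

End Span.

(* The module presented by generators X and relations r = 0, r in Rel, where    *)
(* formal sums are lists of (coefficient, generator) pairs. Two formal sums are *)
(* identified when they agree in every module in which the relations hold.      *)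
Section Presented.
Variables (K : fieldType) (X : choiceType) (Rel : set (seq (K * X))).

Definition fsum (W : lmodType K) (f : X -> W) (s : seq (K * X)) : W :=
  \sum_(p <- s) p.1 *: f p.2.

Definition kills (W : lmodType K) (f : X -> W) := forall r, Rel r -> fsum f r = 0.

Definition pres_eq (s t : seq (K * X)) : bool :=
  `[< forall (W : lmodType K) (f : X -> W), kills f -> fsum f s = fsum f t >].

Lemma pres_eq_refl : reflexive pres_eq.
Proof. by move=> s; apply/asboolP. Qed.

Lemma pres_eq_sym : symmetric pres_eq.
Proof.
by move=> s t; apply/asboolP/asboolP => H W f Hf; rewrite H.
Qed.

Lemma pres_eq_trans : transitive pres_eq.
Proof.
move=> t s u /asboolP Hst /asboolP Htu; apply/asboolP=> W f Hf.
by rewrite Hst // Htu.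
Qed.

Canonical pres_equiv := EquivRel pres_eq pres_eq_refl pres_eq_sym pres_eq_trans.

Local Open Scope quotient_scope.

Definition presented := {eq_quot pres_equiv}.
HB.instance Definition _ := Choice.on presented.
HB.instance Definition _ := EqQuotient.on presented.

Local Open Scope quotient_scope.

Lemma fsum_repr (W : lmodType K) (f : X -> W) s :
  kills f -> fsum f (repr (\pi_presented s)) = fsum f s.
Proof.
move=> Hf; have := reprK (\pi_presented s) => /eqmodP/asboolP; exact.
Qed.

Lemma presented_ext (x y : presented) :
  (forall (W : lmodType K) (f : X -> W), kills f ->
     fsum f (repr x) = fsum f (repr y)) -> x = y.
Proof.
move=> H; rewrite -(reprK x) -(reprK y); apply/eqmodP/asboolP; exact: H.
Qed.

Lemma fsum_cat (W : lmodType K) (f : X -> W) s t :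
  fsum f (s ++ t) = fsum f s + fsum f t.
Proof. exact: big_cat. Qed.

Definition pres_scale_seq (a : K) (s : seq (K * X)) := [seq (a * p.1, p.2) | p <- s].

Lemma fsum_scale (W : lmodType K) (f : X -> W) a s :
  fsum f (pres_scale_seq a s) = a *: fsum f s.
Proof.
by rewrite /fsum big_map scaler_sumr; apply: eq_bigr => p _; rewrite scalerA.
Qed.

Definition pres_add (x y : presented) : presented := \pi_presented (repr x ++ repr y).
Definition pres_scale a (x : presented) : presented := \pi_presented (pres_scale_seq a (repr x)).
Definition pres_zero : presented := \pi_presented [::].
Definition pres_opp x := pres_scale (-1) x.

Let E := (fsum_repr, fsum_cat, fsum_scale).

Fact pres_addA : associative pres_add.
Proof. by move=> x y z; apply: presented_ext=> W f Hf; rewrite !E // addrA. Qed.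
Fact pres_addC : commutative pres_add.
Proof. by move=> x y; apply: presented_ext=> W f Hf; rewrite !E // addrC. Qed.
Fact pres_add0 : left_id pres_zero pres_add.
Proof. by move=> x; apply: presented_ext=> W f Hf; rewrite !E // /fsum big_nil add0r. Qed.
Fact pres_addN : left_inverse pres_zero pres_opp pres_add.
Proof.
move=> x; apply: presented_ext=> W f Hf.
by rewrite !E // scaleN1r addNr /fsum big_nil.
Qed.

HB.instance Definition _ :=
  GRing.isZmodule.Build presented pres_addA pres_addC pres_add0 pres_addN.

Fact pres_scaleA a b x : pres_scale a (pres_scale b x) = pres_scale (a * b) x.
Proof. by apply: presented_ext=> W f Hf; rewrite !E // scalerA. Qed.
Fact pres_scale1 : left_id 1 pres_scale.
Proof. by move=> x; apply: presented_ext=> W f Hf; rewrite !E // scale1r. Qed.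
Fact pres_scaleDr : right_distributive pres_scale +%R.
Proof. by move=> a x y; apply: presented_ext=> W f Hf; rewrite !E // scalerDr. Qed.
Fact pres_scaleDl x : {morph pres_scale^~ x : a b / a + b}.
Proof. by move=> a b; apply: presented_ext=> W f Hf; rewrite !E // scalerDl. Qed.

HB.instance Definition _ := GRing.Zmodule_isLmodule.Build K presented
  pres_scaleA pres_scale1 pres_scaleDr pres_scaleDl.

Definition gen (g : X) : presented := \pi_presented [:: (1, g)].

Definition plift (W : lmodType K) (f : X -> W) (Hf : kills f) (x : presented) : W :=
  fsum f (repr x).

Fact plift_linear (W : lmodType K) (f : X -> W) (Hf : kills f) : linear (plift Hf).
Proof.
move=> a x y; rewrite /plift -[a *: x]/(pres_scale a x) -[_ + y]/(pres_add _ y).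
by rewrite !E.
Qed.

HB.instance Definition _ (W : lmodType K) (f : X -> W) (Hf : kills f) :=
  GRing.isLinear.Build K presented W *:%R (plift Hf) (plift_linear Hf).

Lemma plift_gen (W : lmodType K) (f : X -> W) (Hf : kills f) g :
  plift Hf (gen g) = f g.
Proof. by rewrite /plift !E // /fsum big_seq1 scale1r. Qed.

Lemma pi_fsum s : \pi_presented s = fsum gen s.
Proof.
elim: s => [|[a g] s IH]; first by rewrite /fsum big_nil.
rewrite /fsum big_cons -/(fsum gen s) -IH /=.
apply: presented_ext => W f Hf.
rewrite -[_ + _]/(pres_add _ _) -[a *: _]/(pres_scale a _) !E //.
by rewrite /fsum big_cons big_seq1 /= scale1r.
Qed.

Lemma gen_kills : kills gen.
Proof.
move=> r Rr; rewrite -pi_fsum; apply: presented_ext => W f Hf.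
by rewrite -[0]/pres_zero !E // Hf // /fsum big_nil.
Qed.

Lemma presented_ind (M : set presented) :
  is_submodule M -> (forall g, M (gen g)) -> forall x, M x.
Proof.
move=> [M0 MP] Mg x; rewrite -(reprK x) pi_fsum.
elim: (repr x) => [|[a g] s IH]; first by rewrite /fsum big_nil.
by rewrite /fsum big_cons; apply: MP.
Qed.

Lemma presented_eq (W : lmodType K) (f g : {linear presented -> W}) :
  (forall x, f (gen x) = g (gen x)) -> f =1 g.
Proof. by move=> fg; apply: presented_ind => //; apply: eq_submod. Qed.

End Presented.

Arguments gen {K X} Rel g.

Section Tensor.
Context {K : fieldType}.

Inductive tens_rel (U V : lmodType K) : set (seq (K * (U * V))) :=
| TensRelL a u u' v :
    tens_rel [:: (1, (a *: u + u', v)); (- a, (u, v)); (- 1, (u', v))]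
| TensRelR a u v v' :
    tens_rel [:: (1, (u, a *: v + v')); (- a, (u, v)); (- 1, (u, v'))].

Definition tensor (U V : lmodType K) := presented (@tens_rel U V).
HB.instance Definition _ (U V : lmodType K) := GRing.Lmodule.on (tensor U V).

Definition pure (U V : lmodType K) (u : U) (v : V) : tensor U V :=
  gen (@tens_rel U V) (u, v).

Lemma rel3_eq (W : lmodType K) a (x y z : W) :
  1 *: x + (- a *: y + (- 1 *: z + 0)) = 0 <-> x = a *: y + z.
Proof.
rewrite scale1r addr0 scaleNr scaleN1r -opprD; split=> [/eqP|->]; last exact: subrr.
by rewrite subr_eq0 => /eqP.
Qed.

Lemma pure_bilinear (U V : lmodType K) : bilinear_for *:%R *:%R (@pure U V).
Proof.
split=> [v a u u'|u a v v'] /=.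
- by have := gen_kills (TensRelL a u u' v); rewrite /fsum !big_cons big_nil /= => /rel3_eq.
- by have := gen_kills (TensRelR a u v v'); rewrite /fsum !big_cons big_nil /= => /rel3_eq.
Qed.

Lemma pure0l (U V : lmodType K) (v : V) : pure (0 : U) v = 0.
Proof.
have /= := (@pure_bilinear U V).1 v (-1) 0 0.
by rewrite scaler0 addr0 scaleN1r addNr.
Qed.

Lemma pure0r (U V : lmodType K) (u : U) : pure u (0 : V) = 0.
Proof.
have /= := (@pure_bilinear U V).2 u (-1) 0 0.
by rewrite scaler0 addr0 scaleN1r addNr.
Qed.

Lemma bilinear_kills (U V W : lmodType K) (f : U -> V -> W) :
  bilinear_for *:%R *:%R f -> kills (@tens_rel U V) (fun p => f p.1 p.2).
Proof.
move=> [fl fr] r [a u u' v|a u v v']; rewrite /fsum !big_cons big_nil /=; apply/rel3_eq.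
- exact: fl.
- exact: fr.
Qed.

Definition tens_lift (U V W : lmodType K) (f : U -> V -> W)
    (Hf : bilinear_for *:%R *:%R f) : {linear tensor U V -> W} :=
  plift (bilinear_kills Hf).

Lemma tens_liftE (U V W : lmodType K) (f : U -> V -> W)
    (Hf : bilinear_for *:%R *:%R f) u v : tens_lift Hf (pure u v) = f u v.
Proof. exact: plift_gen. Qed.

Lemma tensor_ind (U V : lmodType K) (M : set (tensor U V)) :
  is_submodule M -> (forall u v, M (pure u v)) -> forall x, M x.
Proof. by move=> Mm Mp; apply: presented_ind => // -[u v]; apply: Mp. Qed.

Lemma tensor_eq (U V W : lmodType K) (f g : {linear tensor U V -> W}) :
  (forall u v, f (pure u v) = g (pure u v)) -> f =1 g.
Proof. by move=> fg; apply: tensor_ind => //; apply: eq_submod. Qed.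

Lemma tens_map_subproof (U V U' V' : lmodType K)
    (f : {linear U -> U'}) (g : {linear V -> V'}) :
  bilinear_for *:%R *:%R (fun u v => pure (f u) (g v)).
Proof.
have [bl br] := @pure_bilinear U' V'.
by split=> [v a u u'|u a v v'] /=; rewrite linearP; [apply: bl|apply: br].
Qed.

Definition tens_map (U V U' V' : lmodType K) (f : {linear U -> U'})
    (g : {linear V -> V'}) : {linear tensor U V -> tensor U' V'} :=
  tens_lift (tens_map_subproof f g).

Lemma tens_mapE (U V U' V' : lmodType K) (f : {linear U -> U'})
    (g : {linear V -> V'}) u v : tens_map f g (pure u v) = pure (f u) (g v).
Proof. exact: tens_liftE. Qed.

Definition tmul (A : unitalAlg K) : {linear tensor A A -> A} :=
  tens_lift (amul_bilinear A).

Lemma tmulE (A : unitalAlg K) (x y : A) : tmul A (pure x y) = amul x y.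
Proof. exact: tens_liftE. Qed.

End Tensor.

Notation "u ⊗ v" := (pure u v) (at level 40, left associativity) : ring_scope.

(* The tensor algebra is spanned by words v_1 ... v_n of vectors, subject to    *)
(* linearity in each letter; words of length r span the component of degree r.  *)
Section TensorAlgebra.
Context {K : fieldType}.
Variable V : lmodType K.

Inductive word_rel : set (seq (K * seq V)) :=
| WordRel a v v' (l r : seq V) :
    word_rel [:: (1, l ++ (a *: v + v') :: r);
                 (- a, l ++ v :: r); (- 1, l ++ v' :: r)].

Definition tmod := presented word_rel.
HB.instance Definition _ := GRing.Lmodule.on tmod.

Definition tword (w : seq V) : tmod := gen word_rel w.

Definition multilinear (W : lmodType K) (f : seq V -> W) :=
  forall (a : K) v v' l r,
    f (l ++ (a *: v + v') :: r) = a *: f (l ++ v :: r) + f (l ++ v' :: r).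

Lemma tword_multilinear : multilinear tword.
Proof.
move=> a v v' l r; have := gen_kills (WordRel a v v' l r).
by rewrite /fsum !big_cons big_nil /= => /rel3_eq.
Qed.

Lemma multilinear_kills (W : lmodType K) (f : seq V -> W) :
  multilinear f -> kills word_rel f.
Proof.
move=> Hf r [a v v' l r']; rewrite /fsum !big_cons big_nil /=; apply/rel3_eq.
exact: Hf.
Qed.

Definition tword_lift (W : lmodType K) (f : seq V -> W) (Hf : multilinear f) :
  {linear tmod -> W} := plift (multilinear_kills Hf).

Lemma tword_liftE (W : lmodType K) (f : seq V -> W) (Hf : multilinear f) w :
  tword_lift Hf (tword w) = f w.
Proof. exact: plift_gen. Qed.

Lemma tmod_ind (M : set tmod) :
  is_submodule M -> (forall w, M (tword w)) -> forall x, M x.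
Proof. exact: presented_ind. Qed.

Lemma tmod_eq (W : lmodType K) (f g : {linear tmod -> W}) :
  (forall w, f (tword w) = g (tword w)) -> f =1 g.
Proof. exact: presented_eq. Qed.

Lemma multilinear_comp (W W' : lmodType K) (g : {linear W -> W'}) (f : seq V -> W) :
  multilinear f -> multilinear (g \o f).
Proof. by move=> Hf a v v' l r /=; rewrite Hf linearP. Qed.

Lemma multilinear_catl (W : lmodType K) (f : seq V -> W) w :
  multilinear f -> multilinear (fun w' => f (w ++ w')).
Proof. by move=> Hf a v v' l r; rewrite !catA Hf. Qed.

Lemma multilinear_catr (W : lmodType K) (f : seq V -> W) w :
  multilinear f -> multilinear (fun w' => f (w' ++ w)).
Proof. by move=> Hf a v v' l r; rewrite -!catA !cat_cons Hf. Qed.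

Definition lmulw (w : seq V) : {linear tmod -> tmod} :=
  tword_lift (multilinear_catl w tword_multilinear).

Lemma lmulwE w w' : lmulw w (tword w') = tword (w ++ w').
Proof. exact: tword_liftE. Qed.

Lemma lmulw_multilinear y : multilinear (fun w => lmulw w y).
Proof.
move=> a v v' l r.
have Mx : is_submodule [set y | lmulw (l ++ (a *: v + v') :: r) y =
            a *: lmulw (l ++ v :: r) y + lmulw (l ++ v' :: r) y].
  split=> [|b x z /= Hx Hz]; first by rewrite /= !linear0 ?scaler0 addr0.
  by rewrite !linearP /= Hx Hz !scalerDr !scalerA (mulrC b a) addrACA.
apply: (tmod_ind Mx) => w /=; rewrite !lmulwE.
exact: (multilinear_catr w tword_multilinear).
Qed.

Definition talg_mul (x y : tmod) : tmod := tword_lift (lmulw_multilinear y) x.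

Lemma talg_mul_word w y : talg_mul (tword w) y = lmulw w y.
Proof. exact: tword_liftE. Qed.

Fact talg_mul_linl y : linear (talg_mul^~ y).
Proof. by move=> a x x'; rewrite /talg_mul linearP. Qed.

Fact talg_mul_linr x : linear (talg_mul x).
Proof.
move=> a y y'; move: x; apply: tmod_ind => [|w]; last first.
  by rewrite /= !talg_mul_word linearP.
split=> [|b x z /= Hx Hz]; first by rewrite /= /talg_mul !linear0 ?scaler0 addr0.
by rewrite !talg_mul_linl Hx Hz !scalerDr !scalerA (mulrC b a) addrACA.
Qed.

Fact talg_mul_bilinear : bilinear_for *:%R *:%R talg_mul.
Proof. by split=> x a y y'; [apply: talg_mul_linl|apply: talg_mul_linr]. Qed.

Lemma wwE w w' : talg_mul (tword w) (tword w') = tword (w ++ w').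
Proof. by rewrite talg_mul_word lmulwE. Qed.

Fact talg_mulA : associative talg_mul.
Proof.
move=> x y z; move: x; apply: tmod_ind => [|u].
  split=> [|a x x' /= Hx Hx']; first by rewrite /= /talg_mul !linear0.
  by rewrite !talg_mul_linl Hx Hx'.
move: y; apply: tmod_ind => [|v].
  split=> [|a x x' /= Hx Hx']; first by rewrite /= !(talg_mul_word u) linear0 /talg_mul !linear0.
  by rewrite /= !(talg_mul_linl, talg_mul_linr) Hx Hx'.
move: z; apply: tmod_ind => [|w]; last by rewrite /= !wwE catA.
split=> [|a x x' /= Hx Hx']; first by rewrite /= !wwE !talg_mul_word !linear0.
by rewrite /= !talg_mul_linr Hx Hx'.
Qed.

Fact talg_mul1 : left_id (tword [::]) talg_mul.
Proof.
move=> y; move: y; apply: tmod_ind => [|w]; last by rewrite /= wwE.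
split=> [|a x x' /= Hx Hx']; first by rewrite /= talg_mul_word linear0.
by rewrite talg_mul_linr Hx Hx'.
Qed.

Fact talg_mul1r : right_id (tword [::]) talg_mul.
Proof.
move=> y; move: y; apply: tmod_ind => [|w]; last by rewrite /= wwE cats0.
split=> [|a x x' /= Hx Hx']; first by rewrite /= /talg_mul linear0.
by rewrite talg_mul_linl Hx Hx'.
Qed.

Definition talg : unitalAlg K :=
  UnitalAlg talg_mul_bilinear talg_mulA talg_mul1 talg_mul1r.

Definition word (w : seq V) : talg := tword w.

Lemma word_multilinear : multilinear (W := talg) word.
Proof. exact: tword_multilinear. Qed.

Definition word_lift (W : lmodType K) (f : seq V -> W) (Hf : multilinear f) :
  {linear talg -> W} := tword_lift Hf.

Lemma word_liftE (W : lmodType K) (f : seq V -> W) (Hf : multilinear f) w :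
  word_lift Hf (word w) = f w.
Proof. exact: tword_liftE. Qed.

Lemma talg_ind (M : set talg) :
  is_submodule M -> (forall w, M (word w)) -> forall x, M x.
Proof. exact: tmod_ind. Qed.

Lemma talg_eq (W : lmodType K) (f g : {linear talg -> W}) :
  (forall w, f (word w) = g (word w)) -> f =1 g.
Proof. exact: presented_eq. Qed.

Lemma word_cat w w' : word (w ++ w') = amul (word w) (word w').
Proof. exact: esym (wwE w w'). Qed.

Lemma word_nil : word [::] = aone talg. Proof. by []. Qed.

Definition tpow (r : nat) : set talg := lspan (word @` [set w | size w = r]).

Definition tpow2 (r s : nat) : set (tensor talg talg) :=
  lspan [set z | exists x y, [/\ tpow r x, tpow s y & z = x ⊗ y]].

End TensorAlgebra.

Arguments tpow {K} V r.
Arguments tpow2 {K} V r s.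

Arguments talg {K} V : simpl never.
Arguments acarrier {K} _ : simpl never.

Section Split.
Context {K : fieldType}.
Variable V : lmodType K.

Fact tsplit_subproof r :
  multilinear (fun w : seq V => word (take r w) ⊗ word (drop r w)).
Proof.
have [bl br] := @pure_bilinear K (talg V) (talg V).
move=> a v v' l q; rewrite !take_cat !drop_cat; case: ltnP => _.
  by rewrite word_multilinear br.
case: (r - size l)%N => [|n]; rewrite ?take0 ?drop0 /=.
  by rewrite -[_ :: q]cat0s word_multilinear !cat0s br.
by rewrite word_multilinear bl.
Qed.

(* Inverts, for each s, the multiplication isomorphism V^r (x) V^s -> V^(r+s). *)
Definition tsplit (r : nat) : {linear talg V -> tensor (talg V) (talg V)} :=
  word_lift (@tsplit_subproof r).

Lemma tsplitE r w : tsplit r (word w) = word (take r w) ⊗ word (drop r w).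
Proof. exact: word_liftE. Qed.

Lemma mul_tsplit r x : tmul _ (tsplit r x) = x.
Proof.
have H : (tmul _ \o tsplit r) =1 (idfun : {linear talg V -> talg V}).
  by apply: talg_eq => w /=; rewrite tsplitE tmulE -word_cat cat_take_drop.
exact: H.
Qed.

Lemma tens_word_eq (W : lmodType K) (f g : {linear tensor (talg V) (talg V) -> W}) :
  (forall w w', f (word w ⊗ word w') = g (word w ⊗ word w')) -> f =1 g.
Proof.
have [bl br] := @pure_bilinear K (talg V) (talg V).
move=> fg; apply: tensor_eq => x y; move: x; apply: talg_ind => [|w].
  split=> [|a x x' Hx Hx']; first by rewrite /= pure0l !linear0.
  by rewrite bl !linearP; exact: congr2 (congr1 _ Hx) Hx'.
move: y; apply: talg_ind => [|w']; last exact: fg.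
split=> [|a x x' Hx Hx']; first by rewrite /= pure0r !linear0.
by rewrite br !linearP; exact: congr2 (congr1 _ Hx) Hx'.
Qed.

Lemma tpow_word w : tpow V (size w) (word w).
Proof. by apply: lspan_sub; exists w. Qed.

Lemma tpow2_words w w' : tpow2 V (size w) (size w') (word w ⊗ word w').
Proof. by apply: lspan_sub; exists (word w), (word w'); split=> //; apply: tpow_word. Qed.

Lemma tpow2_ind r s (M : set (tensor (talg V) (talg V))) : is_submodule M ->
  (forall w w', size w = r -> size w' = s -> M (word w ⊗ word w')) ->
  tpow2 V r s `<=` M.
Proof.
have [bl br] := @pure_bilinear K (talg V) (talg V).
move=> Mm Mw; apply: lspan_ind => // _ [x [y [Vx Vy ->]]].
have linl (t : talg V) : is_submodule [set z : talg V | M (t ⊗ z)].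
  split=> [|a u v Mu Mv] /=; last by rewrite br; apply: Mm.2.
  by rewrite /= pure0r; apply: Mm.1.
have linr (t : talg V) : is_submodule [set z : talg V | M (z ⊗ t)].
  split=> [|a u v Mu Mv] /=; last by rewrite bl; apply: Mm.2.
  by rewrite /= pure0l; apply: Mm.1.
suff H : tpow V r `<=` [set z : talg V | M (z ⊗ y)] by apply: H.
apply: lspan_ind => // _ [w wr <-] /=.
suff H : tpow V s `<=` [set z : talg V | M (word w ⊗ z)] by apply: H.
by apply: lspan_ind => // _ [w' ws <-]; apply: Mw.
Qed.

Lemma mul_tpow2 r s z : tpow2 V r s z -> tpow V (r + s) (tmul (talg V) z).
Proof.
suff : tpow2 V r s `<=` tmul (talg V) @^-1` (tpow V (r + s)) by apply.
apply: tpow2_ind.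
  exact/preim_submod/lspan_submod.
move=> w w' <- <-; rewrite /= tmulE -word_cat -size_cat; exact: tpow_word.
Qed.

Lemma tsplit_tpow r s x : tpow V (r + s) x -> tpow2 V r s (tsplit r x).
Proof.
suff : tpow V (r + s) `<=` tsplit r @^-1` (tpow2 V r s) by apply.
apply: lspan_ind; first exact/preim_submod/lspan_submod.
move=> _ [w /= wrs <-] /=; rewrite tsplitE.
have := @tpow2_words (take r w) (drop r w).
by rewrite size_drop size_takel wrs ?addKn ?leq_addr.
Qed.

Lemma tsplit_mul r s z : tpow2 V r s z -> tsplit r (tmul _ z) = z.
Proof.
suff : tpow2 V r s `<=` [set z | tsplit r (tmul _ z) = z] by apply.
apply: tpow2_ind.
  exact: (@eq_submod _ _ _ (tsplit r \o tmul _) idfun).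
by move=> w w' <- _ /=; rewrite tmulE -word_cat tsplitE take_size_cat // drop_size_cat.
Qed.

End Split.

Arguments tsplit {K V} r.

Section Cochains.
Context {K : fieldType}.

Record linAut (U : lmodType K) := LinAut {
  aut :> {linear U -> U} ;
  autV : {linear U -> U} ;
  autK : cancel aut autV ;
  autVK : cancel autV aut
}.

Definition aut_inv (U : lmodType K) (f : linAut U) : linAut U :=
  LinAut (autVK f) (autK f).

Definition aut_comp (U : lmodType K) (f g : linAut U) : linAut U :=
  @LinAut U (f \o g) (autV g \o autV f)
    (can_comp (autK f) (autK g)) (can_comp (autVK g) (autVK f)).

Lemma tens_map_can (U V : lmodType K) (f f' : {linear U -> U}) (g g' : {linear V -> V}) :
  cancel f f' -> cancel g g' -> cancel (tens_map f g) (tens_map f' g').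
Proof.
move=> fK gK; apply: (tensor_eq (f := tens_map f' g' \o tens_map f g) (g := idfun)).
by move=> u v /=; rewrite !tens_mapE fK gK.
Qed.

Definition tens_aut (U V : lmodType K) (f : linAut U) (g : linAut V) :
    linAut (tensor U V) :=
  @LinAut _ (tens_map f g) (tens_map (autV f) (autV g))
    (tens_map_can (autK f) (autK g)) (tens_map_can (autVK f) (autVK g)).

Lemma aut_image_inv (U : lmodType K) (f : linAut U) (S : set U) :
  f @` S = S -> autV f @` S = S.
Proof.
move=> fS; rewrite -[in LHS]fS image_comp; apply/seteqP; split.
  by move=> _ [x Sx <-]; rewrite /= autK.
by move=> x Sx; exists x => //=; rewrite autK.
Qed.

Variable V : lmodType K.
Local Notation T := (talg V).

Record cochain1 := Cochain1 {
  cochain1_aut :> linAut T ;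
  cochain1P : forall r, cochain1_aut @` tpow V r = tpow V r
}.

Record cochain2 := Cochain2 {
  cochain2_aut :> linAut (tensor T T) ;
  cochain2P : forall r s, cochain2_aut @` tpow2 V r s = tpow2 V r s
}.

Fact delta1_multilinear (theta : {linear T -> T}) (y : T) :
  multilinear (fun w : seq V => tsplit (size w) (theta (amul (word w) y))).
Proof.
move=> a v v' l r; rewrite word_multilinear (amul_bilinear T).1 !linearP.
by rewrite !size_cat.
Qed.

Fact delta1_bilinear (theta : {linear T -> T}) : bilinear_for *:%R *:%R
  (fun x y : T => word_lift (delta1_multilinear theta y) x).
Proof.
split=> [y a x x'|x a y y'] /=; first by rewrite linearP.
move: x; apply: talg_ind => [|w]; last first.
  rewrite /= !word_liftE; have /= -> := (amul_bilinear T).2 (word w) a y y'.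
  by rewrite !linearP.
split=> [|b x x' /= Hx Hx']; first by rewrite /= !linear0 addr0.
by rewrite !linearP /= Hx Hx' !scalerDr !scalerA (mulrC b a) addrACA.
Qed.

(* On V^r (x) V^s this is theta on V^(r+s), carried along the multiplication    *)
(* isomorphism; see [delta1_linE].                                              *)
Definition delta1_lin (theta : {linear T -> T}) :
  {linear tensor T T -> tensor T T} := tens_lift (delta1_bilinear theta).

Arguments delta1_lin : simpl never.

Lemma delta1_linE theta r s z :
  tpow2 V r s z -> delta1_lin theta z = tsplit r (theta (tmul T z)).
Proof.
suff : tpow2 V r s `<=` [set z | delta1_lin theta z = tsplit r (theta (tmul T z))] by apply.
apply: tpow2_ind.
  exact: (@eq_submod _ _ _ (delta1_lin theta) (tsplit r \o theta \o tmul T)).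
by move=> w w' <- _ /=; rewrite tens_liftE word_liftE tmulE.
Qed.

Lemma delta1_tpow2 (theta : {linear T -> T}) :
  (forall r, theta @` tpow V r `<=` tpow V r) ->
  forall r s, delta1_lin theta @` tpow2 V r s `<=` tpow2 V r s.
Proof.
move=> tV r s _ [z Vz <-]; rewrite (delta1_linE _ Vz); apply: tsplit_tpow; apply: tV.
by exists (tmul T z) => //; apply: mul_tpow2.
Qed.

Lemma delta1_can (theta theta' : {linear T -> T}) :
  (forall r, theta @` tpow V r `<=` tpow V r) ->
  cancel theta theta' -> cancel (delta1_lin theta) (delta1_lin theta').
Proof.
move=> tV tK.
have H r s z : tpow2 V r s z -> delta1_lin theta' (delta1_lin theta z) = z.
  move=> Vz; rewrite (@delta1_linE theta' r s); last first.
    by apply: (delta1_tpow2 tV); exists z.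
  by rewrite (delta1_linE _ Vz) mul_tsplit tK (tsplit_mul Vz).
have Hw w w' := H _ _ _ (@tpow2_words _ _ w w').
exact: (tens_word_eq (f := delta1_lin theta' \o delta1_lin theta) (g := idfun)).
Qed.

Lemma cochain1_sub (theta : cochain1) r : theta @` tpow V r `<=` tpow V r.
Proof. by rewrite cochain1P. Qed.

Lemma cochain1V_sub (theta : cochain1) r : autV theta @` tpow V r `<=` tpow V r.
Proof. by rewrite (aut_image_inv (cochain1P theta r)). Qed.

Definition delta1_aut (theta : cochain1) : linAut (tensor T T) :=
  LinAut (delta1_can (@cochain1_sub theta) (autK theta))
         (delta1_can (@cochain1V_sub theta) (autVK theta)).

Fact delta1_subproof (theta : cochain1) r s :
  delta1_aut theta @` tpow2 V r s = tpow2 V r s.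
Proof.
apply/seteqP; split; first exact: delta1_tpow2 (@cochain1_sub theta) _ _.
move=> z Vz; exists (autV (delta1_aut theta) z); last exact: autVK.
by apply: (delta1_tpow2 (@cochain1V_sub theta)); exists z.
Qed.

Definition delta1 (theta : cochain1) : cochain2 := Cochain2 (delta1_subproof theta).

Definition coboundary (theta : cochain1) : linAut (tensor T T) :=
  aut_comp (delta1 theta) (aut_inv (tens_aut theta theta)).

Definition cohomologous (theta : cochain1) (phi psi : cochain2) : Prop :=
  aut_comp (delta1 theta) (aut_comp phi (aut_inv (tens_aut theta theta))) =1 psi.

Definition counital1 (theta : cochain1) : Prop := theta (aone T) = aone T.

Definition counital2 (psi : cochain2) : Prop :=
  forall a : T, psi (aone T ⊗ a) = aone T ⊗ a /\ psi (a ⊗ aone T) = a ⊗ aone T.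

(* psi_{r+s,t} (psi_{r,s} (x) id) = psi_{r,s+t} (id (x) psi_{s,t}): each         *)
(* identification V^p (x) V^q = V^(p+q) is made explicit by [tmul T].           *)
Definition is_cocycle2 (psi : cochain2) : Prop :=
  forall r s t (x y z : T), tpow V r x -> tpow V s y -> tpow V t z ->
    tmul T (psi (tens_map (tmul T) idfun (tens_map psi idfun ((x ⊗ y) ⊗ z)))) =
    tmul T (psi (tens_map idfun (tmul T) (tens_map idfun psi (x ⊗ (y ⊗ z))))).

Record Z2 := CounitalCocycle2 {
  Z2_cochain :> cochain2 ;
  Z2_counital : counital2 Z2_cochain ;
  Z2_cocycle : is_cocycle2 Z2_cochain
}.

End Cochains.

Section QuantumSpaces.
Context {K : fieldType}.

(* The finite-dimensional generating subspace is given by an embedding.         *)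
Record quantumSpace := QuantumSpace {
  qalg :> unitalAlg K ;
  qgen : vectType K ;
  qinc : {linear qgen -> qalg} ;
  qinc_inj : injective qinc ;
  qinc_gen : subalg (range qinc) = setT
}.

Definition is_qmor (A B : quantumSpace) (f : {linear A -> B}) : Prop :=
  [/\ f (aone A) = aone B,
      forall x y, f (amul x y) = amul (f x) (f y) &
      forall v, exists w, f (qinc A v) = qinc B w].

Definition qiso (A B : quantumSpace) : Prop :=
  exists (f : {linear A -> B}) (g : {linear B -> A}),
    [/\ is_qmor f, is_qmor g, cancel f g & cancel g f].

Section Projection.
Variable A : quantumSpace.
Local Notation T := (talg (qgen A)).

Fact qproj_multilinear :
  multilinear (W := A) (foldr (fun v x => amul (qinc A v) x) (aone A)).
Proof.
have [bl br] := amul_bilinear A.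
move=> a v v' l r; elim: l => [|u l /= ->]; last exact: br.
by rewrite /= linearP; apply: bl.
Qed.

(* The canonical epimorphism Pi from the tensor algebra. *)
Definition qproj : {linear T -> A} := word_lift qproj_multilinear.

Definition qproj2 : {linear tensor T T -> tensor A A} := tens_map qproj qproj.

Definition admissible1 (theta : cochain1 (qgen A)) : Prop :=
  theta @` [set x | qproj x = 0] = [set x | qproj x = 0].

Definition admissible2 (psi : cochain2 (qgen A)) : Prop :=
  psi @` [set z | qproj2 z = 0] = [set z | qproj2 z = 0].

Arguments qproj : simpl never.
Arguments qproj2 : simpl never.

Lemma qproj_word w :
  qproj (word w) = foldr (fun v x => amul (qinc A v) x) (aone A) w.
Proof. exact: word_liftE. Qed.

Lemma qproj1 : qproj (aone T) = aone A.
Proof. by rewrite -word_nil qproj_word. Qed.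

Lemma qproj_letter v : qproj (word [:: v]) = qinc A v.
Proof. by rewrite qproj_word /= amulr1. Qed.

Lemma qproj_mul z : qproj (tmul T z) = tmul A (qproj2 z).
Proof.
apply: (tens_word_eq (f := qproj \o tmul T) (g := tmul A \o qproj2)) => w w' /=.
rewrite tens_mapE !tmulE -word_cat !qproj_word.
elim: w => [|v w /= ->]; first by rewrite amul1.
by rewrite amulA.
Qed.

Lemma image_submod (U W : lmodType K) (f : {linear U -> W}) : is_submodule (range f).
Proof.
split=> [|a _ _ [x _ <-] [y _ <-]]; first by exists 0; rewrite ?linear0.
by exists (a *: x + y); rewrite ?linearP.
Qed.

Lemma qproj_surj x : exists y, qproj y = x.
Proof.
have : subalg (range (qinc A)) x by rewrite qinc_gen.
have /smallest_sub : is_subalgebra (range qproj).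
  split; first exact: image_submod.
    by exists (aone T) => //; apply: qproj1.
  move=> _ _ [u _ <-] [v _ <-]; exists (amul u v) => //.
  by rewrite -!tmulE qproj_mul /= tens_mapE.
move=> /(_ (range (qinc A))) H /H [|y _ <-]; last by exists y.
by move=> _ [v _ <-]; exists (word [:: v]) => //; apply: qproj_letter.
Qed.

Lemma qproj2_surj x : exists y, qproj2 y = x.
Proof.
suff : range qproj2 x by move=> [y _ <-]; exists y.
move: x; apply: tensor_ind; first exact: image_submod.
move=> u v; have [u' <-] := qproj_surj u; have [v' <-] := qproj_surj v.
by exists (u' ⊗ v') => //; apply: tens_mapE.
Qed.

End Projection.

Section Twisting.
Variables (A : quantumSpace) (psi : Z2 (qgen A)) (adm : admissible2 psi).
Local Notation T := (talg (qgen A)).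

Definition twist_op (x : tensor A A) : tensor A A :=
  qproj2 A (psi (sval (cid (qproj2_surj x)))).

(* Psi o Pi^2 = Pi^2 o psi, which determines Psi since Pi^2 is onto. *)
Lemma twist_opE z : twist_op (qproj2 A z) = qproj2 A (psi z).
Proof.
rewrite /twist_op; case: cid => y /= yz.
have : (psi @` [set z | qproj2 A z = 0]) (psi (y - z)).
  by exists (y - z) => //=; rewrite linearB /= yz subrr.
by rewrite adm /= !linearB /= => /eqP; rewrite subr_eq0 => /eqP.
Qed.

Fact twist_op_linear : linear twist_op.
Proof.
move=> a x y; have [x' <-] := qproj2_surj x; have [y' <-] := qproj2_surj y.
by rewrite -linearP !twist_opE !linearP.
Qed.

HB.instance Definition _ :=
  GRing.isLinear.Build K (tensor A A) (tensor A A) *:%R twist_op twist_op_linear.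

Definition twist_mul (x y : A) : A := tmul A (twist_op (x ⊗ y)).

Fact twist_mul_bilinear : bilinear_for *:%R *:%R twist_mul.
Proof.
have [bl br] := @pure_bilinear K A A.
by split=> [y a x x'|x a y y'] /=; rewrite /twist_mul ?bl ?br !linearP.
Qed.

Lemma twist_mulE x y :
  twist_mul (qproj A x) (qproj A y) = qproj A (tmul T (psi (x ⊗ y))).
Proof. by rewrite qproj_mul -twist_opE /qproj2 tens_mapE. Qed.

Let star (x y : T) : T := tmul T (psi (x ⊗ y)).

Let star_linl y : linear (star^~ y).
Proof. by move=> a x x'; rewrite /star (@pure_bilinear K T T).1 !linearP. Qed.

Let star_linr x : linear (star x).
Proof. by move=> a y y'; rewrite /star (@pure_bilinear K T T).2 !linearP. Qed.

Let star0l y : star 0 y = 0.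
Proof. by rewrite /star pure0l !linear0. Qed.

Let star0r x : star x 0 = 0.
Proof. by rewrite /star pure0r !linear0. Qed.

Let starA : associative star.
Proof.
move=> x y z; move: x; apply: talg_ind => [|u].
  split=> [|a x x' /= Hx Hx']; first by rewrite /= !star0l.
  by rewrite !star_linl Hx Hx'.
move: y; apply: talg_ind => [|v].
  split=> [|a y y' /= Hy Hy']; first by rewrite /= star0l !star0r star0l.
  by rewrite star_linl !star_linr star_linl Hy Hy'.
move: z; apply: talg_ind => [|w].
  split=> [|a z z' /= Hz Hz']; first by rewrite /= !star0r.
  by rewrite !star_linr Hz Hz'.
have := Z2_cocycle psi (@tpow_word _ _ u) (@tpow_word _ _ v) (@tpow_word _ _ w).
by rewrite !tens_mapE.
Qed.

Fact twist_mulA : associative twist_mul.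
Proof.
move=> x y z; have [x' <-] := qproj_surj x; have [y' <-] := qproj_surj y.
by have [z' <-] := qproj_surj z; rewrite !twist_mulE; exact: congr1 (starA x' y' z').
Qed.

Fact twist_mul1 : left_id (aone A) twist_mul.
Proof.
move=> x; have [x' <-] := qproj_surj x.
by rewrite -qproj1 twist_mulE (Z2_counital psi x').1 tmulE amul1.
Qed.

Fact twist_mulr1 : right_id (aone A) twist_mul.
Proof.
move=> x; have [x' <-] := qproj_surj x.
by rewrite -qproj1 twist_mulE (Z2_counital psi x').2 tmulE amulr1.
Qed.

Definition twist_alg : unitalAlg K :=
  UnitalAlg twist_mul_bilinear twist_mulA twist_mul1 twist_mulr1.

Definition twist_inc : {linear qgen A -> twist_alg} := qinc A.

Fact twist_gen : subalg (range twist_inc) = setT.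
Proof.
apply/seteqP; split=> // x _ S [[Sm S1 SM] Sinc].
have [y <-] := qproj_surj x; move: y; apply: talg_ind.
  exact: (preim_submod (qproj A) Sm).
suff H r : tpow (qgen A) r `<=` qproj A @^-1` S.
  by move=> w; apply: (H (size w)); apply: tpow_word.
elim: r => [|r IH]; apply: lspan_ind; try exact: (preim_submod (qproj A) Sm).
  by move=> _ [w /size0nil -> <-] /=; rewrite qproj_word.
move=> _ [[|v w] //= [wr] <-] /=.
suff H : tpow2 (qgen A) 1 r `<=` (qproj A \o (tmul T \o psi)) @^-1` S.
  have : tpow2 (qgen A) 1 r (word [:: v] ⊗ word w).
    by rewrite -wr; apply: (@tpow2_words _ _ [:: v]).
  rewrite -(cochain2P psi) => -[z /H Sz zE]; move: Sz => /=.
  by rewrite zE tmulE -word_cat.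
apply: lspan_ind; first exact: (preim_submod (qproj A \o (tmul T \o psi)) Sm).
move=> _ [x1 [x2 [V1 V2 ->]]] /=; rewrite -twist_mulE; apply: SM; last exact: IH.
suff H : tpow (qgen A) 1 `<=` qproj A @^-1` S by apply: H.
apply: lspan_ind; first exact: (preim_submod (qproj A) Sm).
move=> _ [[|u [|? ?]] //= _ <-] /=; rewrite qproj_letter.
by apply: Sinc; exists u.
Qed.

Definition twist : quantumSpace :=
  @QuantumSpace twist_alg (qgen A) twist_inc (@qinc_inj A) twist_gen.

End Twisting.

End QuantumSpaces.

Arguments quantumSpace : clear implicits.
Arguments admissible1 {K} A theta.
Arguments admissible2 {K} A psi.
Arguments twist {K} A psi adm.

(* Main.v *)
Require Import Defs.
From HB Require Import structures.
From mathcomp Require Import all_boot all_algebra.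
From mathcomp Require Import boolp classical_sets reals complex.

Set Implicit Arguments.
Unset Strict Implicit.
Unset Printing Implicit Defensive.

Import GRing.Theory.
Local Open Scope classical_set_scope.
Local Open Scope ring_scope.

(** Write [T] for the tensor algebra of the generating space [V]. A counital
    2-cocycle [phi] turns [T] into a unital associative algebra [T_phi] with
    product [star phi x y], the image of [phi (x ⊗ y)] under the usual
    multiplication, and the projection onto the quantum space [A] is an algebra
    map from [T_phi] onto the twist of [A] by [phi]. The theorem becomes a
    statement about these algebras through two facts.

    First, [phi] and [psi] are cohomologous through [theta] exactly when [theta]
    is an algebra map from [T_phi] to [T_psi] ([cohomologousP]): multiplication
    is injective on each [V^r ⊗ V^s], so nothing is lost by multiplying out the
    identity that defines the relation.

    Second, [T_phi] is free on [V], as [T] is: [v ⊗ x |-> star phi v x] is a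
    bijection from [V ⊗ V^n] onto [V^(n+1)], being multiplication after the
    automorphism [phi]. Hence a linear map [a] of [V] extends uniquely to a
    graded algebra map [star_ext phi psi a] from [T_phi] to [T_psi]
    ([star_ext_mul]), invertible when [a] is.

    An isomorphism [f] between the twists restricts to an automorphism [a] of
    [V]. Both [f] after the projection and the projection after
    [star_ext phi psi a] are algebra maps on [T_phi] that agree on [V], so they
    are equal ([qproj_star_ext]); thus the extension preserves the kernel of the
    projection and is the cochain sought. Conversely an admissible [theta]
    descends to the quotient [A], and its values in degree 1 stay in [V]
    ([qiso_twist_cohomologous]). Comparing a quantum space with one of its twists
    is the case where [phi] is the identity cocycle, and two cocycles with the
    same image in [A ⊗ A] define the same product on [A], so that the identity
    is an isomorphism of the twists. *)

(** * Linear maps on tensor products and on the tensor algebra *)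

Section TensorLemmas.
Context {K : fieldType}.

(** One-variable forms of [pure], declared linear so that identities on the
    tensor algebra can be checked on words by comparing linear maps. *)
Definition pure_right (U V : lmodType K) (u : U) (v : V) : tensor U V := u ⊗ v.
Definition pure_left (U V : lmodType K) (v : V) (u : U) : tensor U V := u ⊗ v.

Fact pure_right_linear (U V : lmodType K) (u : U) : linear (@pure_right U V u).
Proof. exact: (@pure_bilinear K U V).2. Qed.

Fact pure_left_linear (U V : lmodType K) (v : V) : linear (@pure_left U V v).
Proof. exact: (@pure_bilinear K U V).1. Qed.

HB.instance Definition _ (U V : lmodType K) (u : U) :=
  GRing.isLinear.Build K V (tensor U V) *:%R (pure_right u)
    (pure_right_linear u).
HB.instance Definition _ (U V : lmodType K) (v : V) :=
  GRing.isLinear.Build K U (tensor U V) *:%R (pure_left v)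
    (pure_left_linear v).

Lemma tens_map_tpow2 (V : lmodType K) (f g : {linear talg V -> talg V}) r s :
  (forall x, tpow V r x -> tpow V r (f x)) ->
  (forall x, tpow V s x -> tpow V s (g x)) ->
  forall z, tpow2 V r s z -> tpow2 V r s (tens_map f g z).
Proof.
move=> fr gs.
suff : tpow2 V r s `<=` tens_map f g @^-1` tpow2 V r s by [].
apply: lspan_ind; first exact/preim_submod/lspan_submod.
move=> _ [x [y [rx sy ->]]]; rewrite /preimage /= tens_mapE.
by apply: lspan_sub; exists (f x), (g y); split=> //; [apply: fr|apply: gs].
Qed.

Fact tmap_multilinear (V : lmodType K) (a : {linear V -> V}) :
  multilinear (W := talg V) (fun w => word (map a w)).
Proof. by move=> c v v' l r; rewrite !map_cat /= linearP word_multilinear. Qed.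

Definition tmap (V : lmodType K) (a : {linear V -> V}) :
  {linear talg V -> talg V} := word_lift (tmap_multilinear a).

Lemma tmap_word (V : lmodType K) (a : {linear V -> V}) w :
  tmap a (word w) = word (map a w).
Proof. exact: word_liftE. Qed.

Lemma tmap_tpow (V : lmodType K) (a : {linear V -> V}) r x :
  tpow V r x -> tpow V r (tmap a x).
Proof.
suff : tpow V r `<=` tmap a @^-1` tpow V r by apply.
apply: lspan_ind; first exact/preim_submod/lspan_submod.
move=> _ [w /= <- <-]; rewrite /preimage /= tmap_word -(size_map a w).
exact: tpow_word.
Qed.

Lemma tmapK (V : lmodType K) (a b : {linear V -> V}) :
  cancel a b -> cancel (tmap a) (tmap b).
Proof.
move=> aK; apply: (talg_eq (f := tmap b \o tmap a) (g := idfun)) => w /=.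
by rewrite !tmap_word mapK.
Qed.

Lemma tpow1_letter (V : lmodType K) x :
  tpow V 1 x -> exists v : V, x = word [:: v].
Proof.
move: x; apply: lspan_ind => [|_ [[|v []] //= _ <-]]; last by exists v.
have L (c : K) (v v' : V) :
    word [:: c *: v + v'] = c *: word [:: v] + word [:: v'].
  exact: (word_multilinear c v v' [::] [::]).
split=> [|c _ _ [v ->] [v' ->]]; last by exists (c *: v + v').
by exists 0; have := L (-1) 0 0; rewrite scaler0 addr0 scaleN1r addNr.
Qed.

End TensorLemmas.

(** * The twisted product on the tensor algebra *)

Section Star.
Context {K : fieldType}.
Variable V : lmodType K.
Local Notation T := (talg V).
Implicit Types phi psi : cochain2 V.

Definition star phi (x y : T) : T := tmul T (phi (x ⊗ y)).

Definition starl phi (x : T) : {linear T -> T} := tmul T \o (phi \o pure_right x).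
Definition starr phi (y : T) : {linear T -> T} := tmul T \o (phi \o pure_left y).

Lemma cochain2_tpow2 phi r s z : tpow2 V r s z -> tpow2 V r s (phi z).
Proof. by move=> Vz; rewrite -(cochain2P phi); exists z. Qed.

Lemma cochain2V_tpow2 phi r s z : tpow2 V r s z -> tpow2 V r s (autV phi z).
Proof. by move=> Vz; rewrite -(aut_image_inv (cochain2P phi r s)); exists z. Qed.

Lemma cochain1_tpow (theta : cochain1 V) r x : tpow V r x -> tpow V r (theta x).
Proof. by move=> Vx; rewrite -(cochain1P theta); exists x. Qed.

Lemma cochain1V_tpow (theta : cochain1 V) r x :
  tpow V r x -> tpow V r (autV theta x).
Proof. by move=> Vx; rewrite -(aut_image_inv (cochain1P theta r)); exists x. Qed.

(** The letters generate the tensor algebra under any twisted product: [phi]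
    permutes [V ⊗ V^n], so the products [star phi v x] span the degree [n + 1].
    Unlike word induction, this matches maps that respect twisted products. *)
Lemma star_ind phi (M : set T) :
  is_submodule M -> M (aone T) ->
  (forall v x, M x -> M (star phi (word [:: v]) x)) -> forall x, M x.
Proof.
move=> Mm M1 Mstar; apply: talg_ind => // w.
suff H n : tpow V n `<=` M by exact: (H (size w) _ (@tpow_word _ _ w)).
elim: n => [|n IH]; first by apply: lspan_ind => // _ [w' /size0nil -> <-].
suff H : tpow2 V 1 n `<=` (tmul T \o phi) @^-1` M.
  move=> x /(@tsplit_tpow _ _ 1 n) /(cochain2V_tpow2 phi) /H.
  by rewrite /preimage /= autVK mul_tsplit.
apply: lspan_ind; first exact: (preim_submod (tmul T \o phi) Mm).
move=> _ [x [y [/tpow1_letter [v ->] Vy ->]]].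
by apply: Mstar; apply: IH.
Qed.

Lemma star1l (phi : Z2 V) x : star phi (aone T) x = x.
Proof. by rewrite /star (Z2_counital phi x).1 tmulE amul1. Qed.

Lemma starA (phi : Z2 V) : associative (star phi).
Proof.
move=> x y z; apply: esym; move: x.
apply: (talg_eq (f := starr phi z \o starr phi y)
  (g := starr phi (star phi y z))) => u.
move: y; apply: (talg_eq (f := starr phi z \o starl phi (word u))
  (g := starl phi (word u) \o starr phi z)) => v.
move: z; apply: (talg_eq (f := starl phi (star phi (word u) (word v)))
  (g := starl phi (word u) \o starl phi (word v))) => w.
have := Z2_cocycle phi (@tpow_word _ _ u) (@tpow_word _ _ v) (@tpow_word _ _ w).
by rewrite !tens_mapE.
Qed.

(** The splitting hidden in [delta1] disappears once multiplied out. *)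
Lemma tmul_delta1 (theta : cochain1 V) z :
  tmul T (delta1 theta z) = theta (tmul T z).
Proof.
move: z; apply: (tens_word_eq (f := tmul T \o delta1 theta)
  (g := theta \o tmul T)) => w w' /=.
by rewrite (delta1_linE theta (@tpow2_words _ _ w w')) mul_tsplit.
Qed.

(** The meaning of the relation: [theta] is multiplicative from the product
    twisted by [phi] to the one twisted by [psi]. *)
Lemma cohomologousP (theta : cochain1 V) phi psi :
  cohomologous theta phi psi <->
  forall x y, theta (star phi x y) = star psi (theta x) (theta y).
Proof.
split=> [coh x y|hom].
  have /(congr1 (tmul T)) := coh (theta x ⊗ theta y).
  by rewrite /= tmul_delta1 tens_mapE !autK.
apply: (tens_word_eq (f := delta1 theta \o phi \o
  tens_map (autV theta) (autV theta)) (g := psi)) => w w' /=.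
have Vz := @tpow2_words _ _ w w'; set z := word w ⊗ word w' in Vz *.
have Vl : tpow2 V (size w) (size w')
    (delta1 theta (phi (tens_map (autV theta) (autV theta) z))).
  apply: cochain2_tpow2; apply: cochain2_tpow2; apply: tens_map_tpow2 => // x;
    exact: cochain1V_tpow.
have Vr := cochain2_tpow2 psi Vz.
(* Both sides lie in V^r ⊗ V^s, where multiplication is injective. *)
rewrite -(tsplit_mul Vl) -(tsplit_mul Vr); congr (tsplit _ _).
by rewrite tmul_delta1 tens_mapE [LHS]hom !autVK.
Qed.

(** * Freeness: extending a map of letters to the twisted tensor algebras *)

Section Extension.

(** In degree [n + 1], write [x] as a sum of products [star phi v y], which
    [autV phi] after splitting off one letter does, and send each of them to
    [star psi (a v) y'], where [y'] is the image of [y]. Outside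
    degree [n] the values are arbitrary. *)
Fixpoint star_ext_deg phi psi (a : {linear V -> V}) n : {linear T -> T} :=
  if n is n'.+1 then
    tmul T \o (psi \o (tens_map (tmap a) (star_ext_deg phi psi a n') \o
      (autV phi \o tsplit 1)))
  else idfun.

Lemma star_ext_degS phi psi a n x : star_ext_deg phi psi a n.+1 x =
  tmul T (psi (tens_map (tmap a) (star_ext_deg phi psi a n)
    (autV phi (tsplit 1 x)))).
Proof. by []. Qed.

Lemma star_ext_deg_tpow phi psi a n x :
  tpow V n x -> tpow V n (star_ext_deg phi psi a n x).
Proof.
elim: n x => [//|n IH] x Vx; rewrite star_ext_degS.
apply: (@mul_tpow2 _ _ 1 n); apply: cochain2_tpow2; apply: tens_map_tpow2 => [y||].
- exact: tmap_tpow.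
- exact: IH.
- by apply: cochain2V_tpow2; apply: (@tsplit_tpow _ _ 1 n).
Qed.

(** Exchanging the two cochains inverts the recursion step by step. *)
Lemma star_ext_degK phi psi (a b : {linear V -> V}) n x :
  cancel a b -> tpow V n x ->
  star_ext_deg psi phi b n (star_ext_deg phi psi a n x) = x.
Proof.
move=> aK; elim: n x => [//|n IH] x Vx; rewrite !star_ext_degS.
have Vz := cochain2V_tpow2 phi (@tsplit_tpow _ _ 1 n _ Vx).
set z := autV phi _ in Vz *.
rewrite (@tsplit_mul _ _ 1 n); last first.
  apply: cochain2_tpow2; apply: tens_map_tpow2 => // y; first exact: tmap_tpow.
  exact: star_ext_deg_tpow.
rewrite autK.
suff -> : tens_map (tmap b) (star_ext_deg psi phi b n)
    (tens_map (tmap a) (star_ext_deg phi psi a n) z) = z.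
  by rewrite autVK mul_tsplit.
move: z Vz; apply: lspan_ind; first exact: (@eq_submod _ _ _
  (tens_map (tmap b) (star_ext_deg psi phi b n) \o
    tens_map (tmap a) (star_ext_deg phi psi a n)) idfun).
move=> _ [u [v [_ Vv ->]]]; rewrite /= !tens_mapE (tmapK aK).
by congr (_ ⊗ _); apply: IH.
Qed.

Fact star_ext_multilinear phi psi a :
  multilinear (W := T) (fun w => star_ext_deg phi psi a (size w) (word w)).
Proof. by move=> c v v' l r; rewrite word_multilinear linearP !size_cat. Qed.

Definition star_ext phi psi a : {linear T -> T} :=
  word_lift (star_ext_multilinear phi psi a).

Lemma star_extE phi psi a n x :
  tpow V n x -> star_ext phi psi a x = star_ext_deg phi psi a n x.
Proof.
move: x; apply: lspan_ind; first exact: eq_submod.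
by move=> _ [w /= <- <-]; rewrite /= word_liftE.
Qed.

Lemma star_ext_tpow phi psi a n x :
  tpow V n x -> tpow V n (star_ext phi psi a x).
Proof. by move=> Vx; rewrite (star_extE _ _ _ Vx); apply: star_ext_deg_tpow. Qed.

Lemma star_extK phi psi (a b : {linear V -> V}) :
  cancel a b -> cancel (star_ext phi psi a) (star_ext psi phi b).
Proof.
move=> aK; apply: (talg_eq (f := star_ext psi phi b \o star_ext phi psi a)
  (g := idfun)) => w /=.
have Vw := @tpow_word _ _ w.
rewrite (star_extE _ _ _ (star_ext_tpow _ _ _ Vw)) (star_extE _ _ _ Vw).
exact: star_ext_degK.
Qed.

Lemma star_ext1 phi psi a : star_ext phi psi a (aone T) = aone T.
Proof. exact: word_liftE. Qed.

(** Multiplicativity for a letter on the left is built into the recursion;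
    associativity of the twisted products propagates it to all factors. *)
Lemma star_ext_letter phi psi a v x :
  star_ext phi psi a (star phi (word [:: v]) x) =
  star psi (word [:: a v]) (star_ext phi psi a x).
Proof.
move: x; apply: (talg_eq (f := star_ext phi psi a \o starl phi (word [:: v]))
  (g := starl psi (word [:: a v]) \o star_ext phi psi a)) => w.
have Vz := cochain2_tpow2 phi (@tpow2_words _ _ [:: v] w).
rewrite /= -[pure_right _ _]/(_ ⊗ _).
rewrite (star_extE _ _ _ (mul_tpow2 Vz)) star_ext_degS (tsplit_mul Vz) autK.
by rewrite tens_mapE tmap_word (star_extE _ _ _ (@tpow_word _ _ w)).
Qed.

Lemma star_ext_mul (phi psi : Z2 V) a x y : star_ext phi psi a (star phi x y) =
  star psi (star_ext phi psi a x) (star_ext phi psi a y).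
Proof.
move: x; apply: (@star_ind phi) => [||v x IH] /=.
- exact: (@eq_submod _ _ _ (star_ext phi psi a \o starr phi y)
    (starr psi (star_ext phi psi a y) \o star_ext phi psi a)).
- by rewrite star1l star_ext1 star1l.
- by rewrite -starA !star_ext_letter IH starA.
Qed.

Variables (phi psi : cochain2 V) (a b : {linear V -> V}).
Hypotheses (aK : cancel a b) (bK : cancel b a).

Definition star_ext_aut : linAut T :=
  LinAut (star_extK phi psi aK) (star_extK psi phi bK).

Fact star_ext_aut_tpow r : star_ext_aut @` tpow V r = tpow V r.
Proof.
apply/seteqP; split=> [_ [x Vx <-]|x Vx]; first exact: star_ext_tpow.
by exists (autV star_ext_aut x); [apply: star_ext_tpow | apply: autVK].
Qed.

Definition star_ext_cochain : cochain1 V := Cochain1 star_ext_aut_tpow.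

End Extension.

(** * The identity cocycle *)

Definition id_aut (U : lmodType K) : linAut U :=
  @LinAut _ U idfun idfun (fun=> erefl) (fun=> erefl).

Definition id_cochain2 : cochain2 V :=
  @Cochain2 _ _ (id_aut _) (fun r s => image_id (tpow2 V r s)).

Fact id_counital2 : counital2 id_cochain2. Proof. by []. Qed.

Fact id_cocycle2 : is_cocycle2 id_cochain2.
Proof. by move=> r s t x y z _ _ _; rewrite !tens_mapE /= !tmulE amulA. Qed.

Definition id_Z2 : Z2 V := CounitalCocycle2 id_counital2 id_cocycle2.

End Star.

(** * Isomorphisms of quantum spaces *)

Section QuantumIso.
Context {K : fieldType}.
Implicit Types A B C : quantumSpace K.

Lemma qmor_comp A B C (f : {linear A -> B}) (g : {linear B -> C}) :
  is_qmor f -> is_qmor g -> is_qmor (g \o f).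
Proof.
move=> [f1 fM fV] [g1 gM gV]; split=> [|x y|v] /=.
- by rewrite f1.
- by rewrite fM gM.
- by have [w ->] := fV v.
Qed.

Lemma qiso_sym A B : qiso A B -> qiso B A.
Proof. by move=> [f [g [mf mg fK gK]]]; exists g, f. Qed.

Lemma qiso_trans A B C : qiso A B -> qiso B C -> qiso A C.
Proof.
move=> [f [f' [mf mf' fK f'K]]] [g [g' [mg mg' gK g'K]]].
exists (g \o f), (f' \o g'); split; try exact: qmor_comp.
- exact: can_comp.
- exact: can_comp.
Qed.

Lemma qiso_intro A B (f : {linear A -> B}) (g : {linear B -> A}) :
  is_qmor f -> cancel f g -> cancel g f ->
  (forall w, exists v, g (qinc B w) = qinc A v) -> qiso A B.
Proof.
move=> mf fK gK gV; have [f1 fM _] := mf; exists f, g; split=> //; split=> // [|x y].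
- by rewrite -f1 fK.
- by rewrite -{1}[x]gK -{1}[y]gK -fM fK.
Qed.

Lemma qmor_letters A B (f : {linear A -> B}) : is_qmor f ->
  exists a : {linear qgen A -> qgen B}, forall v, f (qinc A v) = qinc B (a v).
Proof.
move=> [_ _ /choice[a aE]].
have al : linear a.
  by move=> c v v'; apply: (@qinc_inj _ B); rewrite -aE !linearP /= !aE.
pose aL : {linear qgen A -> qgen B} :=
  HB.pack a (GRing.isLinear.Build K _ _ *:%R a al).
by exists aL.
Qed.

Variable A : quantumSpace K.
Local Notation T := (talg (qgen A)).

Lemma qproj_descent (f : {linear T -> T}) :
  (forall x, qproj A x = 0 -> qproj A (f x) = 0) ->
  exists g : {linear A -> A}, forall x, g (qproj A x) = qproj A (f x).
Proof.
move=> f0; have [s sK] := choice (@qproj_surj _ A).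
pose g x := qproj A (f (s x)).
have gE x : g (qproj A x) = qproj A (f x).
  by apply/eqP; rewrite -subr_eq0 -!linearB f0 // linearB /= sK subrr.
have gl : linear g.
  by move=> c x y; rewrite -[x]sK -[y]sK -linearP !gE !linearP.
pose gL : {linear A -> A} := HB.pack g (GRing.isLinear.Build K _ _ *:%R g gl).
by exists gL.
Qed.

Lemma id_admissible2 : admissible2 A (id_Z2 (qgen A)).
Proof. exact: image_id. Qed.

Lemma twist_id_mul x y : twist_mul (id_Z2 (qgen A)) x y = amul x y.
Proof.
have [x' <-] := qproj_surj x; have [y' <-] := qproj_surj y.
by rewrite (twist_mulE id_admissible2) qproj_mul /qproj2 tens_mapE tmulE.
Qed.

Lemma qiso_twist_id : qiso A (twist A (id_Z2 (qgen A)) id_admissible2).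
Proof.
apply: (@qiso_intro A (twist A _ id_admissible2) idfun idfun) => // [|w].
  by split=> // [x y|v]; [apply/esym/twist_id_mul | exists v].
by exists w.
Qed.

Variables phi psi : Z2 (qgen A).
Hypotheses (hphi : admissible2 A phi) (hpsi : admissible2 A psi).

(** Both sides are algebra maps on the tensor algebra twisted by [phi], and they
    agree on the letters, which generate it. *)
Lemma qproj_star_ext (f : {linear twist A phi hphi -> twist A psi hpsi})
    (a : {linear qgen A -> qgen A}) :
  is_qmor f -> (forall v, f (qinc A v) = qinc A (a v)) ->
  forall x, qproj A (star_ext phi psi a x) = f (qproj A x).
Proof.
move=> [f1 fM _] fa.
apply: (@star_ind _ _ phi) => [||v x IH].
- exact: (@eq_submod _ _ A (qproj A \o star_ext phi psi a) (f \o qproj A)).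
- by rewrite star_ext1 qproj1 f1.
- rewrite star_ext_letter.
  by rewrite -(twist_mulE hpsi) -(twist_mulE hphi) [RHS]fM !qproj_letter fa IH.
Qed.

(** From an isomorphism [f], the cochain extends the restriction of [f] to the
    generators; from a cochain, the isomorphism is the map it induces on [A]. *)
Lemma qiso_twist_cohomologous :
  qiso (twist A phi hphi) (twist A psi hpsi) <->
  exists theta : cochain1 (qgen A),
    [/\ admissible1 A theta, counital1 theta & cohomologous theta phi psi].
Proof.
split=> [[f [g [mf mg fK gK]]]|[theta [adm theta1 /cohomologousP hom]]].
- have [a fa] := qmor_letters mf; have [b gb] := qmor_letters mg.
  have aK : cancel a b.
    by move=> v; apply: (@qinc_inj _ A); rewrite -[LHS]gb -[X in g X]fa fK.
  have bK : cancel b a.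
    by move=> v; apply: (@qinc_inj _ A); rewrite -[LHS]fa -[X in f X]gb gK.
  have projE := qproj_star_ext mf fa.
  exists (star_ext_cochain phi psi aK bK); split.
  + apply/seteqP; split=> [_ [x x0 <-]|x x0].
      by rewrite /mkset [LHS]projE x0 linear0.
    exists (star_ext psi phi b x); last exact: (star_extK psi phi bK).
    apply: (can_inj fK); rewrite linear0 -[LHS]projE.
    by rewrite (star_extK psi phi bK).
  + exact: star_ext1.
  + by apply/cohomologousP => x y; apply: star_ext_mul.
- have [f fE] : exists f : {linear A -> A},
      forall x, f (qproj A x) = qproj A (theta x).
    apply: qproj_descent => x x0.
    by have : (theta @` [set x | qproj A x = 0]) (theta x);
      [exists x | rewrite adm].
  have [g gE] : exists g : {linear A -> A},
      forall x, g (qproj A x) = qproj A (autV theta x).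
    apply: qproj_descent => x x0.
    by have : (autV theta @` [set x | qproj A x = 0]) (autV theta x);
      [exists x | rewrite (aut_image_inv adm)].
  have letter (t : T -> T) (h : A -> A) :
      (forall x, h (qproj A x) = qproj A (t x)) ->
      (forall x, tpow (qgen A) 1 x -> tpow (qgen A) 1 (t x)) ->
      forall v, exists w, h (qinc A v) = qinc A w.
    move=> hE t1 v; have [w tw] := tpow1_letter (t1 _ (@tpow_word _ _ [:: v])).
    by exists w; rewrite -!qproj_letter hE tw.
  have fK : cancel f g.
    by move=> x; have [x' <-] := @qproj_surj _ A x; rewrite fE gE autK.
  have gK : cancel g f.
    by move=> x; have [x' <-] := @qproj_surj _ A x; rewrite gE fE autVK.
  apply: (@qiso_intro (twist A phi hphi) (twist A psi hpsi) f g).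
  + split=> /= [|x y|].
    * by rewrite -qproj1 fE theta1.
    * have [x' <-] := @qproj_surj _ A x; have [y' <-] := @qproj_surj _ A y.
      have fM : f (twist_mul phi (qproj A x') (qproj A y')) =
          twist_mul psi (f (qproj A x')) (f (qproj A y')).
        rewrite (twist_mulE hphi) !fE (twist_mulE hpsi).
        by congr (qproj A _); apply: hom.
      exact: fM.
    * by apply: (letter _ _ fE) => x; apply: cochain1_tpow.
  + exact: fK.
  + exact: gK.
  + by apply: (letter _ _ gE) => x; apply: cochain1V_tpow.
Qed.

(** The twisted product on [A] only sees the cocycle modulo the kernel. *)
Lemma qiso_twist_congr : (forall z, qproj2 A (phi z) = qproj2 A (psi z)) ->
  qiso (twist A phi hphi) (twist A psi hpsi).
Proof.
move=> eqpp.
apply: (@qiso_intro (twist A phi hphi) (twist A psi hpsi) idfun idfun)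
  => // [|w]; last by exists w.
split=> // [x y|v]; last by exists v.
have [x' <-] := @qproj_surj _ A x; have [y' <-] := @qproj_surj _ A y.
suff: twist_mul phi (qproj A x') (qproj A y') =
    twist_mul psi (qproj A x') (qproj A y') by [].
by rewrite (twist_mulE hphi) (twist_mulE hpsi) !qproj_mul eqpp.
Qed.

End QuantumIso.

(** * The classification of twists *)

Theorem theorem9 (R : realType) (K : fieldType)
    (hK : K = (R : fieldType) \/ K = (R[i] : fieldType))
    (A : quantumSpace K) :
  (forall (psi : Z2 (qgen A)) (hpsi : admissible2 A psi),
     qiso A (twist A psi hpsi) <->
     exists theta : cochain1 (qgen A),
       [/\ admissible1 A theta, counital1 theta & psi =1 coboundary theta]) /\
  (forall (phi psi : Z2 (qgen A))
      (hphi : admissible2 A phi) (hpsi : admissible2 A psi),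
     qiso (twist A phi hphi) (twist A psi hpsi) <->
     exists theta : cochain1 (qgen A),
       [/\ admissible1 A theta, counital1 theta & cohomologous theta phi psi]) /\
  (forall (phi psi : Z2 (qgen A))
      (hphi : admissible2 A phi) (hpsi : admissible2 A psi),
     (forall z, qproj2 A (phi z - psi z) = 0) ->
     exists theta : cochain1 (qgen A),
       admissible1 A theta /\ cohomologous theta phi psi).
Proof.
split; last split.
- move=> psi hpsi; have id_iso := qiso_twist_id A.
  split=> [iso|[theta [adm theta1 psiE]]].
    have /qiso_twist_cohomologous[theta [adm theta1 coh]] :=
      qiso_trans (qiso_sym id_iso) iso.
    by exists theta; split=> // z; rewrite -(coh z).
  apply: (qiso_trans id_iso); apply/qiso_twist_cohomologous.
  by exists theta; split=> // z; rewrite psiE.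
- move=> phi psi hphi hpsi; exact: qiso_twist_cohomologous.
- move=> phi psi hphi hpsi eqpp.
  have /qiso_twist_cohomologous[theta [adm _ coh]] :
      qiso (twist A phi hphi) (twist A psi hpsi).
    apply: qiso_twist_congr => z; apply/eqP.
    by rewrite -subr_eq0 -linearB eqpp.
  by exists theta.
Qed.
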